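(* Let $X$ be a real normed linear space of dimension greater than $2$. Then $X$ is an inner product space (i.e. its norm is induced by an inner product) if and only if for all $x, y \in S_X$, $x \perp_B y$ implies both $x \perp_{SB} y$ and $y \perp_{SB} x$.
   Context: $S_X = \{x \in X : \|x\| = 1\}$. For $x, y \in X$: $x \perp_B y$ (Birkhoff-James orthogonality) iff $\|x\| \le \|x + \lambda y\|$ for all scalars $\lambda$; $x \perp_{SB} y$ (strong Birkhoff-James orthogonality) iff $\|x\| < \|x + \lambda y\|$ for all scalars $\lambda \ne 0$. *)

(* Defs.v *)
From HB Require Import structures.
From mathcomp Require Import all_boot all_order all_algebra.
From mathcomp Require Import all_classical all_reals all_analysis.

Set Implicit Arguments.
Unset Strict Implicit.
Unset Printing Implicit Defensive.

Import Order.TTheory GRing.Theory Num.Theory.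
Import numFieldNormedType.Exports.

Local Open Scope classical_set_scope.
Local Open Scope ring_scope.

Definition unit_sphere (R : realType) (X : normedModType R) : set X :=
  [set x : X | `|x| = 1].

Definition bj_orthogonal (R : realType) (X : normedModType R) (x y : X) : Prop :=
  forall l : R, `|x| <= `|x + l *: y|.

Definition strong_bj_orthogonal (R : realType) (X : normedModType R)
    (x y : X) : Prop :=
  forall l : R, l != 0 -> `|x| < `|x + l *: y|.

Definition linearly_independent (R : realType) (X : lmodType R) (m : nat)
    (v : 'I_m -> X) : Prop :=
  forall c : 'I_m -> R, \sum_(i < m) c i *: v i = 0 -> forall i, c i = 0.

(* This covers infinite-dimensional spaces, to which the [\dim] of [vectType]
   does not apply. *)
Definition dim_gt (R : realType) (X : lmodType R) (n : nat) : Prop :=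
  exists v : 'I_n.+1 -> X, linearly_independent v.

(* For [theta := idfun], [{dot X for idfun}] is the library's type of
   symmetric positive definite bilinear forms on [X]. *)
Definition is_inner_product_space (R : realType) (X : normedModType R) : Prop :=
  exists ip : {dot X for idfun}, forall x : X, `|x| = Num.sqrt (ip x x).

Notation "x '\perp_B' y" := (bj_orthogonal x y) (at level 70).
Notation "x '\perp_SB' y" := (strong_bj_orthogonal x y) (at level 70).

(* Main.v *)
Require Import Defs.
From HB Require Import structures.
From mathcomp Require Import all_boot all_order all_algebra.
From mathcomp Require Import all_classical all_reals all_analysis.
From mathcomp Require Import ring lra.

Set Implicit Arguments.
Unset Strict Implicit.
Unset Printing Implicit Defensive.

Import Order.TTheory GRing.Theory Num.Theory.
Import numFieldNormedType.Exports.

Local Open Scope classical_set_scope.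
Local Open Scope ring_scope.

(** Under the hypothesis Birkhoff-James orthogonality is symmetric and the norm
    is smooth, so the directional derivative [ndir x] of the norm at [x] is
    linear and [x \perp_B y] means [ndir x y = 0]. Given [x \perp_B y], choose
    [z] orthogonal to both (this needs dimension 3). The derivative at
    [x + a y + b z] is then proportional to [(1, f a, g b)] on the basis
    [(x, y, z)], and symmetry of orthogonality becomes a functional equation
    which forces [f a = k * a]. Hence
    [`|x + a y| ^ 2 / (1 + k * a ^ 2)] has only quadratic variation in [a] and
    is constant. Exchanging [x] and [y] gives [`|y| ^ 2 = k * `|x| ^ 2], whence
    Pythagoras' theorem for orthogonal pairs, and the polar form equals
    [`|x| * ndir x y], which is linear in [y]. *)

(** * Two facts about real functions *)

Section ConjugacySlopes.
Variables (R : realFieldType) (f g : R -> R).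
Hypothesis conj_sym : forall a a' b b' : R,
  1 + f a * a' + g b * b' = 0 -> 1 + f a' * a + g b' * b = 0.
Hypothesis f_sign : forall a, a != 0 -> 0 < a * f a.
Hypothesis g_sign : forall b, b != 0 -> 0 < b * g b.

(* With [M c = f (c / f 1)], symmetry of the relation makes [M] an involution
   and a morphism for multiplication; comparing with the analogue for [g] gives
   [M (1 + c) > 1] for [c > 0]. So [M] is an increasing involution. *)
Lemma conjugate_slope_linear a : f a = f 1 * a.
Proof.
have f0 : f 0 = 0.
  (* If [f 0] were nonzero, the pair [0], [- (f 0)^-1] would be related, while the reversed relation
     reads [1 = 0]. *)
  apply/eqP; apply: contraT => f0.
  have := @conj_sym 0 (- (f 0)^-1) 0 0.
  by rewrite !mulr0 !addr0 mulrN mulfV// subrr => /(_ erefl)/eqP; rewrite oner_eq0.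
have k0 : 0 < f 1 by have := f_sign (oner_neq0 _); rewrite mul1r.
have m0 : 0 < g 1 by have := g_sign (oner_neq0 _); rewrite mul1r.
set k := f 1 in k0 *; set m := g 1 in m0 *.
have kn : k != 0 by rewrite gt_eqF.
have mn : m != 0 by rewrite gt_eqF.
pose M c := f (c / k); pose M' c := g (c / m).
have M0 : M 0 = 0 by rewrite /M mul0r.
(* The relation is applied with [a = b = 1], where [a'] and [b'] are chosen so that the three terms
   are [1], [c] and [- 1 - c]. *)
have MM' c : M c + M' (- 1 - c) = -1.
  have := @conj_sym 1 (c / k) 1 ((- 1 - c) / m).
  rewrite -/k -/m !mulr1 -/(M c) -/(M' _) => h.
  suff : 1 + M c + M' (- 1 - c) = 0 by move=> ?; lra.
  by apply: h; field; rewrite kn mn.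
have M'gt0 c : 0 < c -> 0 < M' c.
  move=> c0; have c1 : 0 < c / m by rewrite divr_gt0.
  by have := g_sign (lt0r_neq0 c1); rewrite pmulr_rgt0.
have Mgt0 c : 0 < c -> 0 < M c.
  move=> c0; have c1 : 0 < c / k by rewrite divr_gt0.
  by have := f_sign (lt0r_neq0 c1); rewrite pmulr_rgt0.
(* With [b = 1], [b'] is solved from the relation; comparison with [MM'] at [c = f u * v] then
   eliminates [M']. *)
have fM u v : f v * u = M (f u * v).
  have [->|u0] := eqVneq u 0; first by rewrite mulr0 f0 mul0r M0.
  have := @conj_sym u v 1 ((- 1 - f u * v) / m).
  rewrite -/m mulr1 -/(M' _) => h.
  have := MM' (f u * v).
  suff : 1 + f v * u + M' (- 1 - f u * v) = 0 by move=> ? ?; lra.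
  by apply: h; field; rewrite mn.
have TM u v : M v * u / k = M (M u * v / k).
  by rewrite -mulrA fM /M mulrA.
have Mk : M k = k by rewrite /M divff.
have MK u : M (M u) = u.
  by have := TM u k; rewrite Mk mulfK// -mulrA mulrC divfK.
have MX u v : M (u * v / k) = M u * M v / k.
  by have := TM u (M v); rewrite MK => h; rewrite [u * v]mulrC h MK.
have M'0 : M' 0 = 0.
  have g0 : g 0 = 0.
    apply/eqP; apply: contraT => g0.
    have := @conj_sym 0 0 0 (- (g 0)^-1).
    rewrite !mulr0 !addr0 mulrN mulfV// subrr => /(_ erefl)/eqP.
    by rewrite oner_eq0.
  by rewrite /M' mul0r.
have MN1 : M (- 1) = - 1.
  by have := MM' (- 1); rewrite subrr M'0 addr0.
(* Computing [M (1 / k)] from [1 * 1] and from [(- 1) * (- 1)] gives [M 1 ^+ 2 = 1]; positivity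
   picks the sign. *)
have M1 : M 1 = 1.
  have := MX (- 1) (- 1); rewrite MN1 => h; have := MX 1 1.
  rewrite mulr1; rewrite mulrNN mulr1 in h; rewrite h => /(mulIf (invr_neq0 kn)).
  move/eqP; rewrite eq_sym -expr2 sqrf_eq1 => /orP[/eqP//|/eqP e].
  by have := Mgt0 1 ltr01; rewrite e oppr_gt0 ltr10.
have Mdiv v : M (v / k) = M v / k by have := MX 1 v; rewrite M1 !mul1r.
have Mmul u v : M (u * v) = M u * M v.
  apply: (mulIf (invr_neq0 kn)); rewrite -MX Mdiv//.
have MN v : M (- v) = - M v by rewrite -mulN1r Mmul MN1 mulN1r.
(* At [- c], [MM'] reads [M c = 1 + M' (c - 1)]. *)
have Mgt1 c : 1 < c -> 1 < M c.
  move=> c1; have := MM' (- c); rewrite MN => h.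
  suff : 0 < M' (- 1 - - c) by move=> ?; lra.
  by apply: M'gt0; lra.
have Minc u v : 0 < u -> u < v -> M u < M v.
  move=> u0 uv; rewrite -(divfK (lt0r_neq0 u0) v) Mmul -[ltLHS]mul1r.
  rewrite ltr_pM2r ?Mgt0//; apply: Mgt1; by rewrite ltr_pdivlMr// mul1r.
have Mid u : 0 < u -> M u = u.
  move=> u0; have [h|h|//] := ltgtP (M u) u.
    by have := Minc _ _ (Mgt0 _ u0) h; rewrite MK => /(lt_trans h); rewrite ltxx.
  by have := Minc _ _ u0 h; rewrite MK => /(lt_trans h); rewrite ltxx.
have -> : f a = M (k * a) by rewrite /M [k * a]mulrC mulfK.
rewrite Mmul Mk; congr (_ * _).
have [a0|/Mid//|->//] := ltgtP a 0.
by rewrite -[a]opprK MN Mid ?oppr_gt0.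
Qed.

End ConjugacySlopes.

(** Cut [[0, 1]] into [n] equal steps: [h] drops by at most [C / n ^ 2] on each, so by at most
    [C / n] in all, which is less than any given positive drop once [n] is large. *)
Lemma quadratic_variation_le (R : realType) (h : R -> R) (C : R) :
  (forall a b, 0 <= a <= 1 -> 0 <= b <= 1 -> h a - h b <= C * (a - b) ^+ 2) ->
  h 0 <= h 1.
Proof.
move=> hC; rewrite leNgt; apply/negP; rewrite -subr_gt0 => d0.
pose n := (Num.truncn (C / (h 0 - h 1))).+1.
have n0 : 0 < n%:R :> R by rewrite ltr0n.
have : C / (h 0 - h 1) < n%:R by exact: truncnS_gt.
rewrite ltr_pdivrMr// => Cn.
have sub i : (i <= n)%N -> h 0 - h (i%:R / n%:R) <= i%:R * (C / n%:R ^+ 2).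
  elim: i => [_|i IH i_n]; first by rewrite !mul0r subrr.
  have in01 j : (j <= n)%N -> 0 <= (j%:R / n%:R : R) <= 1.
    by move=> jn; rewrite divr_ge0//= ler_pdivrMr// mul1r ler_nat.
  have := hC _ _ (in01 _ (ltnW i_n)) (in01 _ i_n).
  have -> : (i%:R / n%:R - i.+1%:R / n%:R : R) ^+ 2 = (n%:R ^+ 2)^-1.
    by rewrite -natr1; field; rewrite gt_eqF.
  by have := IH (ltnW i_n); rewrite -natr1 mulrDl mul1r => ? ?; lra.
have := sub n (leqnn n); rewrite divff ?gt_eqF//.
have -> : n%:R * (C / n%:R ^+ 2) = C / n%:R by field; rewrite gt_eqF.
rewrite ler_pdivlMr// mulrC => h1.
by move: (lt_le_trans Cn h1); rewrite ltxx.
Qed.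

(** * The one-sided directional derivative of the norm *)

(** By convexity the difference quotient is nondecreasing in [t > 0], so this infimum is the right
    derivative of the norm at [x] along [y]. As an infimum it requires no limits. *)
HB.lock Definition ndir (R : realType) (X : normedModType R) (x y : X) : R :=
  inf [set (`|x + t *: y| - `|x|) / t | t in [set t : R | 0 < t]].

Section DirectionalDerivative.
Variables (R : realType) (X : normedModType R).
Implicit Types (x y z : X) (c t : R).

Lemma ndir_slope x y t : 0 < t -> `|x| + t * ndir x y <= `|x + t *: y|.
Proof.
move=> t0; rewrite unlock -lerBrDl mulrC -ler_pdivlMr//.
apply: ge_inf; last by exists t.
(* The reverse triangle inequality bounds all quotients below by [- |y|]. *)
exists (- `|y|) => _ [s /= s0 <-]; rewrite ler_pdivlMr//.
have := lerB_normD x (s *: y); rewrite normrZ gtr0_norm// => h.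
by move: (`|y|) (`|x|) (`|_ + _|) h => a b c h; lra.
Qed.

Lemma ndir_ge x y c :
  (forall t, 0 < t -> `|x| + t * c <= `|x + t *: y|) -> c <= ndir x y.
Proof.
move=> h; rewrite unlock; apply: lb_le_inf; first by exists ((`|x + 1 *: y| - `|x|) / 1); exists 1 => /=.
move=> _ [t /= t0 <-]; rewrite ler_pdivlMr// mulrC lerBrDl; exact: h.
Qed.

Lemma ndirZ_ge x y c : 0 < c -> c * ndir x y <= ndir x (c *: y).
Proof.
move=> c0; apply: ndir_ge => t t0; rewrite mulrA scalerA.
by apply: ndir_slope; exact: mulr_gt0.
Qed.

Lemma ndirZ_gt0 x y c : 0 < c -> ndir x (c *: y) = c * ndir x y.
Proof.
move=> c0; apply/eqP; rewrite eq_le ndirZ_ge// andbT.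
have ci : 0 < c^-1 by rewrite invr_gt0.
have := ndirZ_ge x (c *: y) ci.
by rewrite scalerA mulVf ?gt_eqF// scale1r mulrC ler_pdivrMr// mulrC.
Qed.

Lemma ndir_line x c : ndir x (c *: x) = c * `|x|.
Proof.
have E t : `|x + t *: (c *: x)| = `|1 + t * c| * `|x|.
  by rewrite scalerA -[X in `|X + _|]scale1r -scalerDl normrZ.
apply/eqP; rewrite eq_le; apply/andP; split; last first.
  apply: ndir_ge => t t0; rewrite E mulrA -{1}[`|x|]mul1r -mulrDl.
  by rewrite ler_wpM2r// ler_norm.
have d0 : 0 < 1 + `|c| by rewrite ltr_pwDl.
have t0 : 0 < (1 + `|c|)^-1 by rewrite invr_gt0.
have := ndir_slope x (c *: x) t0; rewrite E (@ger0_norm _ (1 + _ * c)); last first.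
  have -> : 1 + (1 + `|c|)^-1 * c = (1 + `|c|)^-1 * (1 + `|c| + c).
    by rewrite [RHS]mulrDr mulVf ?gt_eqF.
  rewrite mulr_ge0 ?ltW//.
  have : - `|c| <= c by rewrite lerNl -normrN ler_norm.
  by move=> h; lra.
rewrite mulrDl mul1r lerD2l -mulrA ler_pM2l//.
Qed.

Lemma ndir0 x : ndir x 0 = 0.
Proof. by rewrite -(scale0r x) ndir_line mul0r. Qed.

(** Convexity of the norm: with step [s * t / (s + t)] along [y + z], one reaches the convex
    combination of [x + s *: y] and [x + t *: z] with weights [t / (s + t)] and [s / (s + t)]. *)
Lemma ndirD x y z : ndir x (y + z) <= ndir x y + ndir x z.
Proof.
rewrite -lerBlDr; apply: ndir_ge => s s0.
suff : ndir x (y + z) - (`|x + s *: y| - `|x|) / s <= ndir x z.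
  rewrite lerBlDr -lerBlDl ler_pdivlMr// => h.
  by rewrite -lerBrDl mulrC.
apply: ndir_ge => t t0.
have st0 : 0 < s + t by rewrite addr_gt0.
have st : 0 < s * t / (s + t) by rewrite divr_gt0// mulr_gt0.
have := ndir_slope x (y + z) st.
have H : (s + t) * `|x + (s * t / (s + t)) *: (y + z)| <= t * `|x + s *: y| + s * `|x + t *: z|.
  have e k (v : X) : 0 < k -> k * `|v| = `|k *: v|.
    by move=> k0; rewrite normrZ gtr0_norm.
  rewrite !e//.
  apply: le_trans (ler_normD _ _); rewrite !scalerDr !scalerA.
  rewrite addrACA -scalerDl [t + s]addrC [(s + t) * _]mulrC divfK ?gt_eqF//.
  by rewrite [t * s]mulrC.
move: (ndir x _) (`|x + s *: y|) (`|x + t *: z|) (`|x + _|) H => D A B C H.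
rewrite -(ler_pM2l st0) => /le_trans /(_ H).
rewrite mulrDr mulrA (mulrC (s + t) (_ / _)) divfK ?gt_eqF// => h.
rewrite -(ler_pM2l s0); move: h; move: (`|x|) => N h.
have -> : s * (N + t * (D - (A - N) / s)) = s * N + s * t * D - t * (A - N).
  by field; rewrite gt_eqF.
lra.
Qed.

Lemma ndir_lineD x y c : ndir x (y + c *: x) = ndir x y + c * `|x|.
Proof.
apply/eqP; rewrite eq_le -{1}ndir_line ndirD/=.
have := ndirD x (y + c *: x) (- c *: x).
by rewrite ndir_line scaleNr addrK mulNr -lerBlDr opprK.
Qed.

(** A convex function of [l] is minimal at [0] exactly when neither one-sided derivative points
    downhill. *)
Lemma bj_ndir x y : x \perp_B y <-> 0 <= ndir x y /\ 0 <= ndir x (- y).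
Proof.
split=> [h|[h1 h2] l].
  split; apply: ndir_ge => t t0; rewrite mulr0 addr0; first exact: h.
  by rewrite scalerN -scaleNr; exact: h.
have [l0|l0|->] := ltgtP l 0; last by rewrite scale0r addr0.
  have l1 : 0 < - l by rewrite oppr_gt0.
  have := ndir_slope x (- y) l1; rewrite scaleNr scalerN opprK.
  by apply: le_trans; rewrite lerDl mulr_ge0// ltW.
have := ndir_slope x y l0.
by apply: le_trans; rewrite lerDl mulr_ge0// ltW.
Qed.

End DirectionalDerivative.

(** * Dot products from bilinear forms, and vectors outside a plane *)

Lemma dot_of_form (R : realType) (X : lmodType R) (b : X -> X -> R) :
  (forall x y z c, b x (c *: y + z) = c * b x y + b x z) ->
  (forall x y, b x y = b y x) -> (forall x, x != 0 -> 0 < b x x) ->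
  exists ip : {dot X for idfun}, forall x y, ip x y = b x y.
Proof.
move=> lin sym pos.
have linr x : GRing.linear_for *%R (b x) by move=> c y z; rewrite lin.
have linl y : GRing.linear_for *%R (b ^~ y) by move=> c x z; rewrite !(sym _ y) lin.
have bil : bilinear_for *%R (idfun \; *%R) b.
  by split.
pose B := bilinear_isBilinear.Build R X X R *%R (idfun \; *%R) b bil.
have herm x y : b x y = (-1) ^+ false * idfun (b y x) by rewrite expr0 mul1r sym.
pose H := isHermitianSesquilinear.Build R X false idfun b herm.
pose D := isDotProduct.Build R X b pos.
pose ip : {dot X for idfun} := HB.pack b B H D.
by exists ip.
Qed.

(** Otherwise three independent vectors have a 3 by 2 coordinate matrix; a nonzero vector of its
    left kernel is a linear dependence. *)
Lemma dim_gt2_plane (R : realType) (X : lmodType R) (x y : X) :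
  dim_gt X 2 -> exists z, forall a b, z != a *: x + b *: y.
Proof.
move=> [v vfree]; apply: contrapT => /forallNP h.
have {h} h i : exists ab : R * R, v i = ab.1 *: x + ab.2 *: y.
  apply: contrapT => /forallNP hi; apply: (h (v i)) => a b.
  by apply/eqP; exact: (hi (a, b)).
have [c hc] := choice h.
pose A : 'M[R]_(3, 2) := \matrix_(i, j) if j == 0 then (c i).1 else (c i).2.
have : kermx A != 0.
  rewrite kermx_eq0 /row_free; apply: contraTneq (rank_leq_col A) => ->.
  by [].
case/rowV0Pn => u /sub_kermxP uA /eqP; apply; apply/rowP => i; rewrite mxE.
apply: (vfree (u 0)) => {i}.
have e j : \sum_i u 0 i * A i j = 0 by have /rowP/(_ j) := uA; rewrite !mxE.
have := e 0; have := e 1; rewrite (eq_bigr (fun i => u 0 i * (c i).2)); last first.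
  by move=> i _; rewrite mxE.
move=> e2; rewrite (eq_bigr (fun i => u 0 i * (c i).1)); last first.
  by move=> i _; rewrite mxE.
move=> e1; under eq_bigr do rewrite hc scalerDr !scalerA.
by rewrite big_split/= -!scaler_suml e1 e2 !scale0r addr0.
Qed.

(** * Symmetry of orthogonality and smoothness of the norm *)

Section StrictSymmetry.
Variables (R : realType) (X : normedModType R).
Hypothesis bj_strict_sym : forall x y : X,
  x != 0 -> y != 0 -> x \perp_B y -> y \perp_SB x.
Implicit Types (x y z : X) (c t : R).

Lemma bj_sym x y : x \perp_B y -> y \perp_B x.
Proof.
have [->|x0] := eqVneq x 0; first by move=> _ l; rewrite scaler0 addr0.
have [->|y0] := eqVneq y 0; first by move=> _ l; rewrite normr0.
move=> xy l; have [->|l0] := eqVneq l 0; first by rewrite scale0r addr0.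
by rewrite ltW// bj_strict_sym.
Qed.

Lemma bj_line x c : x != 0 -> x \perp_B (c *: x) -> c = 0.
Proof.
move=> x0 h; apply/eqP; apply: contraT => c0.
have := h (- c^-1).
by rewrite scalerA mulNr mulVf// scaleN1r subrr normr0 normr_le0 (negbTE x0).
Qed.

(** For [c != 0], strictness of [y] against [x] gives [|y| < |y + c *: x|], and strictness of
    [y + c *: x] against [x] gives the opposite inequality. *)
Lemma bj_right_unique x y c :
  x != 0 -> x \perp_B y -> x \perp_B (y + c *: x) -> c = 0.
Proof.
move=> x0 xy xyc; apply/eqP; apply: contraT => c0.
have [y0|y0] := eqVneq y 0.
  by move: xyc; rewrite y0 add0r => /(bj_line x0)/eqP; rewrite (negbTE c0).
have [z0|z0] := eqVneq (y + c *: x) 0.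
  move: xy; rewrite (_ : y = (- c) *: x); last first.
    by apply/eqP; rewrite -subr_eq0 scaleNr opprK z0.
  by move/(bj_line x0)/eqP; rewrite oppr_eq0 (negbTE c0).
have := bj_strict_sym x0 y0 xy c0.
have /(bj_strict_sym x0 z0 xyc) : - c != 0 by rewrite oppr_eq0.
by rewrite scaleNr addrK => /lt_trans h /h; rewrite ltxx.
Qed.

(* Both one-sided derivatives [p] and [q] of the norm at [x] make
   [y - (p / `|x|) *: x] and [y - (q / `|x|) *: x] orthogonal to [x]. *)
Lemma ndirN x y : x != 0 -> ndir x (- y) = - ndir x y.
Proof.
move=> x0; have n0 : `|x| != 0 by rewrite normr_eq0.
have := ndirD x y (- y); rewrite subrr ndir0 => pq.
set q := ndir x y in pq *; set p' := ndir x (- y) in pq *.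
have key a : 0 <= q + a * `|x| -> 0 <= p' - a * `|x| -> x \perp_B (y + a *: x).
  by move=> ? ?; apply/bj_ndir; rewrite opprD -scaleNr !ndir_lineD mulNr.
have h1 : x \perp_B (y + (- (q / `|x|)) *: x).
  by apply: key; rewrite mulNr divfK// ?subrr// opprK addrC.
have h2 : x \perp_B (y + (- (q / `|x|)) *: x + ((q + p') / `|x|) *: x).
  rewrite -addrA -scalerDl mulrDl addKr.
  by apply: key; rewrite divfK// subrr.
have /eqP := bj_right_unique x0 h1 h2.
by rewrite mulf_eq0 invr_eq0 (negbTE n0) orbF addrC addr_eq0 => /eqP.
Qed.

Lemma ndirDE x y z : x != 0 -> ndir x (y + z) = ndir x y + ndir x z.
Proof.
move=> x0; apply/eqP; rewrite eq_le ndirD/=.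
by have := ndirD x (y + z) (- z); rewrite addrK ndirN// lerBrDr.
Qed.

Lemma ndirZ x c y : x != 0 -> ndir x (c *: y) = c * ndir x y.
Proof.
move=> x0; have [c0|c0|->] := ltgtP c 0.
- by rewrite -[c]opprK scaleNr ndirN// ndirZ_gt0 ?oppr_gt0// !mulNr.
- exact: ndirZ_gt0.
- by rewrite mul0r scale0r ndir0.
Qed.

Lemma ndir_self x : ndir x x = `|x|.
Proof. by have := ndir_line x 1; rewrite scale1r mul1r. Qed.

Lemma bj_ndir0 x y : x != 0 -> x \perp_B y <-> ndir x y = 0.
Proof.
move=> x0; split=> [/bj_ndir[]|h]; last by apply/bj_ndir; rewrite ndirN// h oppr0.
by rewrite ndirN// oppr_ge0 => h1 h2; apply/eqP; rewrite eq_le h1 h2.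
Qed.

Lemma ndir_supp x y : x != 0 -> `|x| + ndir x y <= `|x + y|.
Proof. by have := ndir_slope x y ltr01; rewrite scale1r mul1r. Qed.

Lemma ndir_sym x y : x != 0 -> y != 0 -> ndir x y = 0 -> ndir y x = 0.
Proof.
by move=> x0 y0 /(bj_ndir0 _ x0)/bj_sym xy; apply/(bj_ndir0 _ y0).
Qed.

(** By symmetry the vectors orthogonal to [z] form the kernel of the linear map [ndir z]. *)
Lemma ndir_addr_ortho x y z b : x != 0 -> y != 0 -> x + b *: y != 0 ->
  ndir x z = 0 -> ndir y z = 0 -> ndir (x + b *: y) z = 0.
Proof.
move=> x0 y0 xy0 xz yz; have [->|z0] := eqVneq z 0.
  by rewrite ndir0.
apply: ndir_sym => //.
by rewrite ndirDE// ndirZ// !(ndir_sym _ z0)// mulr0 addr0.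
Qed.

(** * Orthogonal pairs and the norm on the planes they span *)

Section OrthogonalPair.
Variables x y : X.
Hypotheses (x0 : x != 0) (y0 : y != 0) (xy : ndir x y = 0).

Lemma addr_ortho_neq0 a : x + a *: y != 0.
Proof.
apply/negP => /eqP h; have := ndirDE x (a *: y) x0.
rewrite h ndirZ// xy mulr0 addr0 ndir_self => /esym/eqP.
by rewrite ndir0 normr_eq0 (negbTE x0).
Qed.

(** Removing [x] from [x + a *: y] strictly lowers the norm, since [y] is strictly orthogonal to
    [x]; the support inequality turns this drop into a positive derivative. *)
Lemma ndir_addr_ortho_gt0 a : 0 < ndir (x + a *: y) x.
Proof.
have [->|a0] := eqVneq a 0; first by rewrite scale0r addr0 ndir_self normr_gt0.
have := ndir_supp (- x) (addr_ortho_neq0 a).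
rewrite ndirN ?addr_ortho_neq0// (addrC x) addrK.
have /(bj_strict_sym x0 y0) : x \perp_B y by apply/bj_ndir0.
have ai : a^-1 != 0 by rewrite invr_eq0.
move=> /(_ _ ai); rewrite -(ltr_pM2l (_ : 0 < `|a|)) ?normr_gt0//.
rewrite -!normrZ scalerDr scalerA divff// scale1r => h1 h2.
by move: (le_lt_trans h2 h1); rewrite gtrDl oppr_lt0.
Qed.

Lemma ndir_addr_ortho_sign a : a != 0 -> 0 < a * ndir (x + a *: y) y.
Proof.
move=> a0; have p0 := addr_ortho_neq0 a.
have := ndir_supp (- (a *: y)) p0.
rewrite ndirN// ndirZ// addrK => h2.
have /(bj_strict_sym y0 x0)/(_ _ a0) h1 : y \perp_B x.
  by apply: bj_sym; apply/bj_ndir0.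
by move: (le_lt_trans h2 h1); rewrite gtrDl oppr_lt0.
Qed.

End OrthogonalPair.

Lemma conjugate_slope x y z : x != 0 -> y != 0 -> z != 0 ->
  ndir x y = 0 -> ndir x z = 0 -> ndir y z = 0 ->
  forall a, ndir (x + a *: y) y =
    ndir (x + y) y / ndir (x + y) x * a * ndir (x + a *: y) x.
Proof.
move=> x0 y0 z0 xy xz yz.
pose f a := ndir (x + a *: y) y / ndir (x + a *: y) x.
pose g b := ndir (x + b *: z) z / ndir (x + b *: z) x.
pose p a b := x + a *: y + b *: z.
have zy := ndir_sym y0 z0 yz.
have zx := ndir_sym x0 z0 xz.
have yx := ndir_sym x0 y0 xy.
have fE a : ndir (x + a *: y) y = f a * ndir (x + a *: y) x.
  by rewrite /f divfK ?gt_eqF// ndir_addr_ortho_gt0.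
have gE b : ndir (x + b *: z) z = g b * ndir (x + b *: z) x.
  by rewrite /g divfK ?gt_eqF// ndir_addr_ortho_gt0.
have xp a b : ndir x (p a b) = `|x|.
  by rewrite !ndirDE// !ndirZ// xy xz !mulr0 !addr0 ndir_self.
have nx0 : `|x| != 0 by rewrite normr_eq0.
have p0 a b : p a b != 0.
  apply: contra nx0 => /eqP h; by rewrite -(xp a b) h ndir0.
have px a b : ndir (p a b) x != 0.
  by apply: contra nx0 => /eqP/(ndir_sym (p0 a b) x0); rewrite xp => ->.
(* The vector [y - f a *: x] is orthogonal to [x + a *: y] and to [z], hence to [p a b]: the slope
   [f a] does not depend on [b]. *)
have py a b : ndir (p a b) y = f a * ndir (p a b) x.
  have q0 := addr_ortho_neq0 x0 xy a.
  have : ndir (p a b) (y + (- f a) *: x) = 0.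
    apply: ndir_addr_ortho => //.
    - exact: p0.
    - by rewrite ndirDE// ndirZ// fE mulNr subrr.
    - by rewrite ndirDE// ndirZ// zx zy mulr0 addr0.
  by rewrite ndirDE// ndirZ// mulNr => /eqP; rewrite subr_eq0 => /eqP.
have pz a b : ndir (p a b) z = g b * ndir (p a b) x.
  have q0 := addr_ortho_neq0 x0 xz b.
  have : ndir (p a b) (z + (- g b) *: x) = 0.
    rewrite /p addrAC; apply: ndir_addr_ortho => //.
    - by rewrite addrAC; exact: p0.
    - by rewrite ndirDE// ndirZ// gE mulNr subrr.
    - by rewrite ndirDE// ndirZ// yx yz mulr0 addr0.
  by rewrite ndirDE// ndirZ// mulNr => /eqP; rewrite subr_eq0 => /eqP.
have pp a b a' b' :
    ndir (p a b) (p a' b') = (1 + f a * a' + g b * b') * ndir (p a b) x.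
  by rewrite !(ndirDE _ _ (p0 a b)) !(ndirZ _ _ (p0 a b)) py pz; ring.
have conj_sym a a' b b' :
    1 + f a * a' + g b * b' = 0 -> 1 + f a' * a + g b' * b = 0.
  move=> h; have : ndir (p a b) (p a' b') = 0 by rewrite pp h mul0r.
  move/(ndir_sym (p0 _ _) (p0 _ _))/eqP.
  by rewrite pp mulf_eq0 (negbTE (px _ _)) orbF => /eqP.
have fs a : a != 0 -> 0 < a * f a.
  by move=> a0; rewrite mulrA divr_gt0 ?ndir_addr_ortho_sign ?ndir_addr_ortho_gt0.
have gs b : b != 0 -> 0 < b * g b.
  by move=> b0; rewrite mulrA divr_gt0 ?ndir_addr_ortho_sign ?ndir_addr_ortho_gt0.
move=> a; rewrite fE (conjugate_slope_linear conj_sym fs gs).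
by rewrite /f scale1r.
Qed.

Lemma norm_plane_sqr x y k : 0 < k -> x != 0 -> y != 0 -> ndir x y = 0 ->
  (forall a, ndir (x + a *: y) y = k * a * ndir (x + a *: y) x) ->
  `|x + y| ^+ 2 = (1 + k) * `|x| ^+ 2.
Proof.
move=> k0 x0 y0 xy hk.
pose n a := `|x + a *: y|; pose q a := 1 + k * a ^+ 2.
have qgt0 a : 1 <= q a by rewrite lerDl mulr_ge0 ?sqr_ge0// ltW.
have nE a : n a = q a * ndir (x + a *: y) x.
  have p0 := addr_ortho_neq0 x0 xy a.
  by rewrite /n -ndir_self /q ndirDE// ndirZ// hk; ring.
(* This is the support inequality at [x + a *: y], tested at [x + a' *: y] and multiplied by
   [q a]. *)
have step a a' : n a * (1 + k * a * a') <= n a' * q a.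
  have p0 := addr_ortho_neq0 x0 xy a.
  have := ndir_supp ((a' - a) *: y) p0.
  rewrite -[x + _ + _]addrA -scalerDl [a + _]addrC subrK.
  rewrite -/(n a') -/(n a) ndirZ// hk => h.
  have -> : n a * (1 + k * a * a') =
      (n a + (a' - a) * (k * a * ndir (x + a *: y) x)) * q a.
    by rewrite nE /q; ring.
  by rewrite ler_pM2r ?(lt_le_trans ltr01).
pose B := (`|x| + `|y|) ^+ 2; pose h a := n a ^+ 2 / q a.
have hB a a' : 0 <= a <= 1 -> 0 <= a' <= 1 ->
    h a - h a' <= k * B * (a - a') ^+ 2.
  move=> /andP[a0 a1] /andP[a'0 a'1].
  have qa := lt_le_trans ltr01 (qgt0 a); have qa' := lt_le_trans ltr01 (qgt0 a').
  have nB : n a ^+ 2 <= B.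
    rewrite ler_sqr ?nnegrE ?addr_ge0 ?normr_ge0//.
    rewrite (le_trans (ler_normD _ _))// lerD2l normrZ ger0_norm//.
    by rewrite -[leRHS]mul1r ler_wpM2r.
  have s2 : (n a * (1 + k * a * a')) ^+ 2 <= (n a' * q a) ^+ 2.
    rewrite ler_sqr ?nnegrE; first exact: step.
      by rewrite mulr_ge0 ?normr_ge0// addr_ge0// !mulr_ge0// ltW.
    by rewrite mulr_ge0 ?normr_ge0// ltW.
  have Q0 : 0 < q a ^+ 2 * q a' by rewrite mulr_gt0// exprn_gt0.
  rewrite -(ler_pM2r Q0).
  have -> : (h a - h a') * (q a ^+ 2 * q a') =
      n a ^+ 2 * q a * q a' - (n a' * q a) ^+ 2.
    by rewrite /h; field; rewrite !gt_eqF.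
  apply: (@le_trans _ _ (n a ^+ 2 * (k * (a - a') ^+ 2))).
    (* The identity is [q a * q a' - (1 + k * a * a') ^+ 2 = k * (a - a') ^+ 2]. *)
    rewrite (_ : _ * (k * _) = n a ^+ 2 * q a * q a' - (n a * (1 + k * a * a')) ^+ 2).
      by rewrite lerD2l lerN2.
    by rewrite /q; ring.
  have d0 : 0 <= k * (a - a') ^+ 2 by rewrite mulr_ge0 ?sqr_ge0// ltW.
  apply: (@le_trans _ _ (k * B * (a - a') ^+ 2)).
    by rewrite [k * B]mulrC -[leRHS]mulrA ler_wpM2r.
  rewrite ler_peMr//; first by rewrite mulrAC mulr_ge0// sqr_ge0.
  by rewrite mulr_ege1// expr2 mulr_ege1.
have /eqP : h 0 = h 1.
  apply/eqP; rewrite eq_le (quadratic_variation_le hB)/=.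
  (* The bound is invariant under [a] to [1 - a], which yields the reverse inequality. *)
  have hB' a a' : 0 <= a <= 1 -> 0 <= a' <= 1 ->
      h (1 - a) - h (1 - a') <= k * B * (a - a') ^+ 2.
    move=> ha ha'; rewrite (_ : (a - a') ^+ 2 = (1 - a - (1 - a')) ^+ 2); last by ring.
    by apply: hB; lra.
  by have := quadratic_variation_le hB'; rewrite subr0 subrr.
rewrite /h /n /q scale0r addr0 scale1r expr0n/= mulr0 addr0 divr1 expr1n mulr1.
have k1 : 1 + k != 0 by rewrite gt_eqF// addr_gt0.
by rewrite eq_sym => /eqP <-; rewrite mulrC divfK.
Qed.

(* Exchanging [x] and [y] replaces the slope [k] by [k^-1]. *)
Lemma ortho_pythagoras x y z : x != 0 -> y != 0 -> z != 0 ->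
  ndir x y = 0 -> ndir x z = 0 -> ndir y z = 0 ->
  `|x + y| ^+ 2 = `|x| ^+ 2 + `|y| ^+ 2.
Proof.
move=> x0 y0 z0 xy xz yz; have yx := ndir_sym x0 y0 xy.
have h1 := conjugate_slope x0 y0 z0 xy xz yz.
have h2 := conjugate_slope y0 x0 z0 yx yz xz.
have := ndir_addr_ortho_gt0 x0 y0 xy 1; have := ndir_addr_ortho_gt0 y0 x0 yx 1.
rewrite !scale1r (addrC y x) => c0 d0.
have := norm_plane_sqr (divr_gt0 c0 d0) x0 y0 xy h1.
move: h2; rewrite (addrC y x) => h2.
have := norm_plane_sqr (divr_gt0 d0 c0) y0 x0 yx h2; rewrite (addrC y x).
move: (ndir _ _) c0 (ndir _ _) d0 => c c0 d d0.
move: (`|x + y| ^+ 2) (`|x| ^+ 2) (`|y| ^+ 2) => P A B e1 e2.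
(* Here [c / d] is the slope [k]; adding the two weighted identities leaves [P = A + B]. *)
have E1 : c * P = (c + d) * B by rewrite e1; field; rewrite gt_eqF.
have E2 : d * P = (c + d) * A by rewrite e2; field; rewrite gt_eqF.
apply: (@mulfI _ (c + d)); first by rewrite gt_eqF// addr_gt0.
by rewrite mulrDr mulrDl E1 E2 addrC.
Qed.


(** * Pythagoras' theorem and the polar form *)

Hypothesis hdim : dim_gt X 2.

Lemma norm_pythagoras x y : x != 0 -> ndir x y = 0 ->
  `|x + y| ^+ 2 = `|x| ^+ 2 + `|y| ^+ 2.
Proof.
move=> x0 xy; have [->|y0] := eqVneq y 0.
  by rewrite normr0 expr0n/= !addr0.
have yx := ndir_sym x0 y0 xy.
have [v hv] := dim_gt2_plane x y hdim.
(* Gram-Schmidt: as [x] and [y] are mutually orthogonal, each correction leaves the other component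
   unchanged. *)
pose z := v + (- (ndir x v / `|x|)) *: x + (- (ndir y v / `|y|)) *: y.
have z0 : z != 0.
  apply: contra (hv (ndir x v / `|x|) (ndir y v / `|y|)).
  by rewrite /z !scaleNr -addrA -opprD subr_eq0.
apply: (@ortho_pythagoras x y z) => //.
  rewrite !ndirDE// !ndirZ// xy ndir_self mulr0 addr0.
  by rewrite mulNr divfK ?normr_eq0// subrr.
rewrite !ndirDE// !ndirZ// yx ndir_self mulr0 addr0.
by rewrite mulNr divfK ?normr_eq0// subrr.
Qed.

(** Write [y = s *: x + w] with [s = ndir x y / |x|] and [w] orthogonal to [x]. By Pythagoras the
    numerator is [((1 + s) ^+ 2 - 1 - s ^+ 2) * |x| ^+ 2 = 2 * s * |x| ^+ 2]. *)
Lemma polar_ndir x y : x != 0 ->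
  (`|x + y| ^+ 2 - `|x| ^+ 2 - `|y| ^+ 2) / 2 = `|x| * ndir x y.
Proof.
move=> x0; have n0 : `|x| != 0 by rewrite normr_eq0.
pose w := y + (- (ndir x y / `|x|)) *: x.
have xw : ndir x w = 0 by rewrite ndir_lineD mulNr divfK// subrr.
have key a : `|a *: x + w| ^+ 2 = a ^+ 2 * `|x| ^+ 2 + `|w| ^+ 2.
  have [->|a0] := eqVneq a 0; first by rewrite scale0r add0r expr0n/= mul0r add0r.
  have -> : a *: x + w = a *: (x + a^-1 *: w).
    by rewrite scalerDr scalerA divff// scale1r.
  rewrite normrZ exprMn norm_pythagoras//; last by rewrite ndirZ// xw mulr0.
  rewrite mulrDr normrZ exprMn mulrA -exprMn -normrM divff// normr1 expr1n mul1r.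
  by rewrite real_normK// num_real.
have := key (ndir x y / `|x|); rewrite /w addrCA scaleNr subrr addr0 -scaleNr -/w.
have := key (1 + ndir x y / `|x|).
rewrite scalerDl scale1r /w (addrC y) addrA scaleNr addrK -scaleNr (addrC _ y) -/w.
by move=> -> ->; field.
Qed.

Lemma strict_sym_inner_product : is_inner_product_space X.
Proof.
pose b x y := (`|x + y| ^+ 2 - `|x| ^+ 2 - `|y| ^+ 2) / 2.
have bxx x : b x x = `|x| ^+ 2.
  by rewrite /b -mulr2n -scaler_nat normrZ normr_nat; field.
have lin x y z c : b x (c *: y + z) = c * b x y + b x z.
  have [->|x0] := eqVneq x 0.
    by rewrite /b normr0 !add0r; field.
  by rewrite /b !polar_ndir// ndirDE// ndirZ//; ring.
have sym x y : b x y = b y x by rewrite /b (addrC x) addrAC.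
have pos x : x != 0 -> 0 < b x x by move=> x0; rewrite bxx exprn_gt0// normr_gt0.
have [ip hip] := dot_of_form lin sym pos.
by exists ip => x; rewrite hip bxx sqrtr_sqr normr_id.
Qed.

End StrictSymmetry.

(** * Inner product spaces, unit vectors and the equivalence *)

Lemma dot_norm_addZ (R : realType) (X : normedModType R)
    (ip : {dot X for idfun}) (hip : forall x : X, `|x| = Num.sqrt (ip x x))
    (x y : X) (l : R) :
  `|x + l *: y| ^+ 2 = `|x| ^+ 2 + 2 * l * ip x y + l ^+ 2 * `|y| ^+ 2.
Proof.
have xx z : `|z| ^+ 2 = ip z z.
  rewrite hip sqr_sqrtr//; have [->|z0] := eqVneq z 0; first by rewrite linear0.
  by rewrite ltW// neq0_dnorm_gt0.
have sym u v : ip u v = ip v u by rewrite hermC expr0 mul1r.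
rewrite !xx linearD linearZ /= !(sym (x + _)) !linearD !linearZ /= (sym y x).
by ring.
Qed.

Theorem theorem2p5 (R : realType) (X : normedModType R) (hdim : dim_gt X 2) :
  is_inner_product_space X <->
  (forall x y : X, unit_sphere x -> unit_sphere y ->
     x \perp_B y -> x \perp_SB y /\ y \perp_SB x).
Proof.
split=> [[ip hip] x y /= x1 y1 xy|h].
  have sqr_le (u v : X) : `|u| <= `|v| -> `|u| ^+ 2 <= `|v| ^+ 2.
    by move=> uv; rewrite ler_sqr ?nnegrE.
  have ip0 : ip x y = 0.
    (* The scalar [- ip x y] minimises the norm since [|y| = 1], and gives
       [|x| ^+ 2 <= |x| ^+ 2 - ip x y ^+ 2]. *)
    have := sqr_le _ _ (xy (- ip x y)); rewrite (dot_norm_addZ hip) y1.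
    move: (ip x y) (`|x|) => p N hp; apply/eqP; rewrite -sqrf_eq0 eq_le sqr_ge0 andbT.
    by lra.
  have lt_of (u v : X) : unit_sphere u -> unit_sphere v -> ip u v = 0 -> u \perp_SB v.
    move=> u1 v1 uv l l0; rewrite -ltr_sqr ?nnegrE//.
    rewrite (dot_norm_addZ hip) uv mulr0 addr0 v1 expr1n mulr1 ltrDl.
    by rewrite exprn_even_gt0.
  by split; apply: lt_of => //; rewrite hermC expr0 mul1r.
apply: strict_sym_inner_product => // x y x0 y0 xy l l0.
have nx : 0 < `|x| by rewrite normr_gt0.
have ny : 0 < `|y| by rewrite normr_gt0.
have unit (z : X) : 0 < `|z| -> unit_sphere (`|z|^-1 *: z).
  by move=> z0; rewrite /unit_sphere/= normrZ normfV normr_id mulVf ?gt_eqF.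
(* Normalising both vectors only rescales the scalar, so the condition on unit vectors passes to all
   nonzero vectors. *)
have scale (u v : X) (m : R) : 0 < `|u| -> 0 < `|v| ->
    `|(`|u|^-1 *: u) + m *: (`|v|^-1 *: v)| = `|u|^-1 * `|u + (m * `|u| / `|v|) *: v|.
  move=> u0 v0; rewrite -[X in X * _]gtr0_norm ?invr_gt0// -normrZ scalerDr !scalerA.
  by congr (`|_ + _ *: v|); field; rewrite !gt_eqF.
have self (u : X) : 0 < `|u| -> `|(`|u|^-1 *: u)| = `|u|^-1 * `|u|.
  by move=> u0; rewrite normrZ gtr0_norm// invr_gt0.
have xy' : (`|x|^-1 *: x) \perp_B (`|y|^-1 *: y).
  by move=> m; rewrite scale// self// ler_pM2l ?invr_gt0.
have [_ /(_ (l * `|x| / `|y|))] := h _ _ (unit _ nx) (unit _ ny) xy'.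
rewrite scale// self// ltr_pM2l ?invr_gt0//.
have -> : l * `|x| / `|y| * `|y| / `|x| = l by field; rewrite !gt_eqF.
apply.
by rewrite !mulf_neq0// ?invr_neq0// gt_eqF.
Qed.
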